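(* Let $\mathbb G=\mathbb G(q,m,\mathbb U)$ be a step-two Carnot group as described in the context, with Carnot–Carathéodory distance $d$ and $d(g)=d(o,g)$. Then for every $g\in\mathbb G$, $$d(g)^2\ \ge\ \sup_{\tau\in\Omega_*}\phi(g;\tau).$$
   Context: Let $q,m\ge1$ and $\mathbb U=\{U^{(1)},\dots,U^{(m)}\}$ be linearly independent real skew-symmetric $q\times q$ matrices. $\mathbb G$ is $\mathbb R^q\times\mathbb R^m$ with the law $(x,t)\cdot(x',t')=(x+x',\,t+t'+\tfrac12\langle\mathbb Ux,x'\rangle)$, where $\langle\mathbb Ux,x'\rangle=(\langle U^{(1)}x,x'\rangle,\dots,\langle U^{(m)}x,x'\rangle)$; $o=(0,0)$. The Carnot–Carathéodory distance is that of the canonical sub-Laplacian $\sum_{l}\mathrm X_l^2$, $\mathrm X_l=\partial_{x_l}+\frac12\sum_j(\sum_kU^{(j)}_{l,k}x_k)\partial_{t_j}$; equivalently $d(o,g)$ is the infimum of $\int_0^1|x'(s)|\,ds$ over absolutely continuous curves $s\mapsto(x(s),t(s))$ from $o$ to $g$ with $t'(s)=\tfrac12\langle\mathbb Ux(s),x'(s)\rangle$ a.e. For $\tau\in\mathbb R^m$, $U(\tau)=i\sum_j\tau_jU^{(j)}$, $\Omega_*=\{\tau:\|U(\tau)\|<\pi\}$ (operator norm), and for $g=(x,t)$, $\phi(g;\tau)=\langle U(\tau)\cot U(\tau)x,x\rangle+4t\cdot\tau$. *)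

(* Defs.v *)
From HB Require Import structures.
From mathcomp Require Import all_boot all_order all_algebra.
From mathcomp Require Import all_classical all_reals all_analysis.
From mathcomp Require Import complex.
Set Implicit Arguments. Unset Strict Implicit. Unset Printing Implicit Defensive.
Import Order.TTheory GRing.Theory Num.Theory.
Import numFieldNormedType.Exports.
Local Open Scope classical_set_scope.
Local Open Scope ring_scope.

Section CarnotDefs.
Variables (R : realType) (q m : nat).

Definition Cmx (a b : nat) (A : 'M[R]_(a, b)) : 'M[R[i]]_(a, b) :=
  map_mx (fun r : R => (r%:C)%C) A.

Definition Utau (U : 'I_m -> 'M[R]_q) (tau : 'cV[R]_m) : 'M[R[i]]_q :=
  ('i)%C *: Cmx (\sum_(j < m) tau j 0 *: U j).

Definition vnormC (v : 'cV[R[i]]_q) : R :=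
  Num.sqrt (\sum_(k < q) ComplexField.Normc.normc (v k 0) ^+ 2).

Definition opnormC (H : 'M[R[i]]_q) : R :=
  sup [set vnormC (H *m v) | v in [set v : 'cV[R[i]]_q | vnormC v <= 1]].

Definition zcotz (z : R) : R := if z == 0 then 1 else z * cos z / sin z.

(* spectral calculus for a normal (here: Hermitian) matrix H = P^-1 D P,
   applied to a real function f of its (real) eigenvalues *)
Definition funmx (f : R -> R) (H : 'M[R[i]]_q) : 'M[R[i]]_q :=
  invmx (spectralmx H) *m
    diag_mx (map_mx (fun z : R[i] => ((f (complex.Re z))%:C)%C) (spectral_diag H))
  *m spectralmx H.

Definition UcotU (H : 'M[R[i]]_q) : 'M[R[i]]_q := funmx zcotz H.

Definition phi (U : 'I_m -> 'M[R]_q) (x : 'cV[R]_q) (t : 'cV[R]_m)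
    (tau : 'cV[R]_m) : R :=
  complex.Re (((Cmx x)^T *m UcotU (Utau U tau) *m Cmx x) 0 0)
  + 4 * \sum_(j < m) t j 0 * tau j 0.

Definition Omega_star (U : 'I_m -> 'M[R]_q) : set 'cV[R]_m :=
  [set tau | opnormC (Utau U tau) < pi].

Definition abs_cont01 (f : R -> R) : Prop :=
  forall e : R, 0 < e -> exists2 d : R, 0 < d &
    forall (n : nat) (a b : 'I_n -> R),
      (forall k, 0 <= a k /\ a k <= b k /\ b k <= 1) ->
      (forall k l, k != l -> b k <= a l \/ b l <= a k) ->
      \sum_(k < n) (b k - a k) < d ->
      \sum_(k < n) `|f (b k) - f (a k)| < e.

Definition horizontal (U : 'I_m -> 'M[R]_q)
    (xs : 'I_q -> R -> R) (ts : 'I_m -> R -> R) : Prop :=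
  (forall l, abs_cont01 (xs l)) /\ (forall j, abs_cont01 (ts j)) /\
  {ae (@lebesgue_measure R), forall s : R, `[0%R, 1%R]%classic s ->
     (forall l, derivable (xs l) s 1) /\
     (forall j, derivable (ts j) s 1 /\
        derive1 (ts j) s = 2^-1 * \sum_(l < q) (\sum_(k < q) U j l k * xs k s)
                                           * derive1 (xs l) s)}.

Definition curve_length (xs : 'I_q -> R -> R) : \bar R :=
  (\int[@lebesgue_measure R]_(s in `[0%R, 1%R])
      (Num.sqrt (\sum_(l < q) (derive1 (xs l) s) ^+ 2))%:E)%E.

Definition dcc (U : 'I_m -> 'M[R]_q) (x : 'cV[R]_q) (t : 'cV[R]_m) : \bar R :=
  ereal_inf [set L | exists (xs : 'I_q -> R -> R) (ts : 'I_m -> R -> R),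
     [/\ horizontal U xs ts,
         (forall l, xs l 0 = 0 /\ xs l 1 = x l 0),
         (forall j, ts j 0 = 0 /\ ts j 1 = t j 0) &
         L = curve_length xs]].

End CarnotDefs.

(* Main.v *)
(** The proof is a calibration. Diagonalize the Hermitian matrix [U(tau)], with
    eigenvalues [lam_k] in [(-pi, pi)], and let [y_k] be the coordinates of the
    horizontal part of a curve in a unitary eigenbasis. Let [F] be the arc
    length, [Lam = eps + F 1], [u = (eps + F) / Lam], and
    [c_k v = lam_k cot (lam_k v)] (read as [1 / v] if [lam_k = 0]). Then
      [G s = Lam * F s - 4 tau . t s - \sum_k c_k (u s) * |y_k s|^2]
    satisfies [G 0 >= 0], and [G' >= 0] almost everywhere because of the Riccati
    equation [c_k' = - (lam_k^2 + c_k^2)]. As [G] is absolutely continuous,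
    [G 1 >= 0], that is [phi <= Lam * F 1]; let [eps] tend to 0. The shift by
    [eps] keeps [u] away from the pole of [c_k]. *)
Require Import Defs.
From HB Require Import structures.
From mathcomp Require Import all_boot all_order all_algebra.
From mathcomp Require Import all_classical all_reals all_analysis.
From mathcomp Require Import measurable_realfun complex.
From mathcomp Require Import ring lra.
Import Order.TTheory GRing.Theory Num.Theory.
Import numFieldNormedType.Exports.
Local Open Scope classical_set_scope.
Local Open Scope ring_scope.
Local Notation normc := ComplexField.Normc.normc.

(** * Unitary diagonalization of a Hermitian matrix, read in real coordinates *)

Section Spectral.
Variables (R : realType) (q : nat).
Implicit Types (P : 'M[R[i]]_q) (v w : 'cV[R]_q) (d : 'I_q -> R).

Let re P k v : R := \sum_(l < q) complex.Re (P k l) * v l 0.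
Let im P k v : R := \sum_(l < q) complex.Im (P k l) * v l 0.

Lemma mulmx_Cmx P v k : (P *m Cmx v) k 0 = (re P k v +i* im P k v)%C.
Proof.
rewrite mxE /re /im.
elim/big_rec3: _ => [|l a b c _ ->] //; rewrite mxE.
case: (P k l) => x y /=.
by apply/eqP; rewrite eq_complex /=; apply/andP; split; apply/eqP; ring.
Qed.

(** On real vectors the real part of the form is symmetric in [v], [w] and the imaginary part
    antisymmetric. The norm and the cotangent form are read off the first, the skew form off the
    second. *)
Lemma hermitian_form_diagE P d v w :
  ((Cmx w)^T *m (map_mx Num.conj P^T *m diag_mx (\row_k (d k)%:C%C) *m P)
     *m Cmx v) 0 0 =
  ((\sum_k d k * (re P k w * re P k v + im P k w * im P k v)) +i*
   (\sum_k d k * (re P k w * im P k v - im P k w * re P k v)))%C.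
Proof.
have E : (Cmx w)^T *m map_mx Num.conj P^T = map_mx Num.conj (P *m Cmx w)^T.
  rewrite trmx_mul map_mxM; congr mulmx.
  apply/matrixP => i j; rewrite !mxE; apply/eqP.
  by rewrite eq_complex /= oppr0 !eqxx.
rewrite !mulmxA E -mulmxA mxE.
elim/big_rec3: _ => [|k a b c _ ->] //.
rewrite mul_mx_diag mulmx_Cmx mxE mxE mxE mulmx_Cmx mxE.
apply/eqP; rewrite eq_complex /=; apply/andP; split; apply/eqP; ring.
Qed.

Definition sqnormC (v : 'cV[R[i]]_q) : R :=
  \sum_(k < q) normc (v k 0) ^+ 2.

Lemma sqr_normc (z : R[i]) :
  normc z ^+ 2 = complex.Re z ^+ 2 + complex.Im z ^+ 2.
Proof.
by case: z => x y /=; rewrite sqr_sqrtr // addr_ge0 // sqr_ge0.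
Qed.

Lemma sqnormCE (v : 'cV[R[i]]_q) :
  ((sqnormC v)%:C)%C = ((map_mx Num.conj v^T) *m v) 0 0.
Proof.
rewrite mxE /sqnormC.
elim/big_rec2: _ => [|k a c _ <-] //; rewrite !mxE.
apply/eqP; rewrite eq_complex sqr_normc; case: (v k 0) => x y /=.
by apply/andP; split; apply/eqP; ring.
Qed.

Lemma sqnormC_unitary P (v' : 'cV[R[i]]_q) : P \is unitarymx -> sqnormC (P *m v') = sqnormC v'.
Proof.
move=> uP; apply: (@complexI R); rewrite !sqnormCE.
rewrite trmx_mul map_mxM -mulmxA (mulmxA _ P) -(map_trmx _ P).
by rewrite (map_trmx _ P) -invmx_unitary // mulVmx ?unitarymx_unit // mul1mx.
Qed.

(** The matrix stretches its [k]-th unit eigenvector by exactly [normc (D 0 k)]. A [sup] is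
    informative only for a bounded set, so boundedness is settled first. *)
Lemma opnormC_ge (P : 'M[R[i]]_q) (D : 'rV[R[i]]_q) k :
  P \is unitarymx ->
  normc (D 0 k) <=
    opnormC (map_mx Num.conj P^T *m diag_mx D *m P).
Proof.
move=> uP; set Q := map_mx Num.conj P^T.
have uQ : Q \is unitarymx by rewrite trmxC_unitary.
have PQ : P *m Q = 1%:M := unitarymxP uP.
have nD (v : 'cV_q) : sqnormC (Q *m diag_mx D *m P *m v) =
    \sum_k normc (D 0 k) ^+ 2 *
            normc ((P *m v) k 0) ^+ 2.
  rewrite -!mulmxA sqnormC_unitary //; apply: eq_bigr => i _.
  by rewrite mul_diag_mx mxE ComplexField.Normc.normcM exprMn.
have : has_ubound [set vnormC ((Q *m diag_mx D *m P) *m v) |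
    v in [set v : 'cV[R[i]]_q | vnormC v <= 1]].
  (* A crude bound suffices: on the unit ball every coordinate of [P *m v] has modulus at most 1. *)
  exists (Num.sqrt (\sum_k normc (D 0 k) ^+ 2)) => _ [v /= v1 <-].
  apply: ler_wsqrtr; rewrite -/(sqnormC _) nD; apply: ler_sum => i _.
  rewrite ler_piMr ?sqr_ge0 //.
  have : sqnormC (P *m v) <= 1.
    rewrite sqnormC_unitary // -(ler_sqrt _ ler01) sqrtr1; exact: v1.
  apply: le_trans; rewrite /sqnormC (bigD1 i) //= lerDl.
  by apply: sumr_ge0 => j _; rewrite sqr_ge0.
move=> /ub_le_sup; apply => /=.
(* The [k]-th column of the conjugate transpose of [P] is the unit eigenvector. *)
exists (Q *m delta_mx k 0).
  rewrite /= /vnormC -/(sqnormC _) sqnormC_unitary // /sqnormC (bigD1 k) //= big1.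
    by rewrite mxE !eqxx mulr1n ComplexField.Normc.normc1 expr1n addr0 sqrtr1.
  by move=> i ik; rewrite mxE (negbTE ik) mulr0n ComplexField.Normc.normc0 expr0n.
rewrite /vnormC -/(sqnormC _) nD (bigD1 k) //= big1.
  rewrite mulmxA PQ mul1mx mxE !eqxx mulr1n.
  rewrite ComplexField.Normc.normc1 expr1n mulr1 addr0 sqrtr_sqr ger0_norm //.
  by case: (D 0 k) => x y; rewrite sqrtr_ge0.
move=> i ik.
rewrite mulmxA PQ mul1mx mxE (negbTE ik) mulr0n.
by rewrite ComplexField.Normc.normc0 expr0n mulr0.
Qed.


(** [a] and [b] are the real and imaginary parts of the unitary matrix [spectralmx H], so
    [a v + i b v] lists the coordinates of [v] in an eigenbasis. The last three items come from one
    diagonal form, with weights [1], [lam] and [zcotz lam]. *)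
Lemma hermitian_spectral (B : 'M[R]_q) (H := ('i)%C *: Cmx B) : B^T = - B ->
  exists (lam : 'I_q -> R) (a b : 'M[R]_q),
  [/\ (forall k, `|lam k| <= opnormC H),
     (forall v, \sum_k ((a *m v) k 0 ^+ 2 + (b *m v) k 0 ^+ 2) =
                \sum_l v l 0 ^+ 2),
     (forall v w, (w^T *m B *m v) 0 0 = \sum_k lam k *
        ((a *m w) k 0 * (b *m v) k 0 - (b *m w) k 0 * (a *m v) k 0)) &
     (forall v, complex.Re (((Cmx v)^T *m UcotU H *m Cmx v) 0 0) =
        \sum_k zcotz (lam k) * ((a *m v) k 0 ^+ 2 + (b *m v) k 0 ^+ 2))].
Proof.
move=> skB; set P := spectralmx H.
have uP : P \is unitarymx by exact: spectral_unitarymx.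
(* Transposition changes the sign of [B], conjugation that of [i]. *)
have hH : H \is hermsymmx.
  apply/is_hermitianmxP; rewrite expr0 scale1r; apply/matrixP => i j.
  have := congr1 (fun M : 'M[R]_q => M i j) skB; rewrite !mxE => ->.
  apply/eqP; rewrite eq_complex /=; apply/andP; split; apply/eqP; ring.
have := hermitian_spectral_diag_real hH.
have /orthomx_spectralP := hermitian_normalmx hH.
rewrite -/P; set D := spectral_diag H => HE /mxOverP realD.
have iP : invmx P = map_mx Num.conj P^T := invmx_unitary uP.
pose lam k := complex.Re (D 0 k).
have DE : D = \row_k (lam k)%:C%C.
  apply/matrixP => i k; rewrite ord1 !mxE.
  have /complex_realP [r rE] := realD 0 k.
  by rewrite /lam rE.
have aE v k : (map_mx (@complex.Re R) P *m v) k 0 = re P k v.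
  by rewrite mxE; apply: eq_bigr => l _; rewrite mxE.
have bE v k : (map_mx (@complex.Im R) P *m v) k 0 = im P k v.
  by rewrite mxE; apply: eq_bigr => l _; rewrite mxE.
exists lam, (map_mx (@complex.Re R) P), (map_mx (@complex.Im R) P); split.
- move=> k; rewrite HE iP.
  apply: (le_trans _ (opnormC_ge P D k uP)).
  by rewrite DE mxE /= expr0n addr0 sqrtr_sqr.
- move=> v.
  have := hermitian_form_diagE P (fun=> 1) v v.
  have -> : diag_mx (\row__ (1 : R)%:C%C) = 1%:M :> 'M[R[i]]_q.
    by apply/matrixP => i j; rewrite !mxE.
  rewrite mulmx1 -iP mulVmx ?unitarymx_unit // mulmx1.
  move=> /(congr1 (@complex.Re R)) /=.
  under [RHS]eq_bigr do rewrite mul1r -!expr2 -aE -bE.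
  move=> <-; rewrite mxE; apply/esym.
  elim/big_rec2: _ => [|l [y1 y2] x _ ->] //; rewrite !mxE /=.
  ring.
- move=> v w.
  (* Since [H] is [i B] with [B] real, the skew form of [B] is the imaginary part of the form of
     [H]. *)
  have := hermitian_form_diagE P lam v w; rewrite -DE -iP -HE.
  move=> /(congr1 (@complex.Im R)) /=.
  under [RHS]eq_bigr do rewrite -!aE -!bE.
  move=> <-; rewrite -scalemxAr -scalemxAl /Cmx map_trmx -!map_mxM.
  rewrite [in RHS]mxE [X in (_ * X)%R]mxE /=.
  ring.
- move=> v.
  under [RHS]eq_bigr => k _ do rewrite aE bE 2!expr2.
  have -> : UcotU H = map_mx Num.conj P^T *m
      diag_mx (\row_k (zcotz (lam k))%:C%C) *m P.
    rewrite -iP /UcotU /funmx -/P -/D; congr (_ *m diag_mx _ *m _).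
    by apply/matrixP => i k; rewrite ord1 !mxE.
  by rewrite (hermitian_form_diagE P (fun k => zcotz (lam k))).
Qed.

End Spectral.

Set Implicit Arguments.
Unset Strict Implicit.

(** * Monotonicity of absolutely continuous functions with nonnegative derivative *)

Section AbsolutelyContinuous.
Variable R : realType.
Implicit Types (f g : R -> R) (s t : R).
Notation mu := (@lebesgue_measure R).

(** Let [c] be the supremum of the points of [0, 1] where [P] holds. The local hypothesis carries
    [P] from a point just left of [c], or [c] itself, past [c], unless 1 is reached. *)
Lemma real_induction01 (P : R -> Prop) : P 0 ->
  (forall c, 0 <= c -> c <= 1 -> exists2 d, 0 < d &
     forall s t, 0 <= s -> s <= c -> c <= t -> t <= 1 ->
       c - d < s -> t < c + d -> P s -> P t) ->
  P 1.
Proof.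
move=> P0 Pc; pose S := [set s | 0 <= s /\ s <= 1 /\ P s].
have S0 : S 0 by split; rewrite ?lexx; split.
have supS : has_sup S.
  by split; [exists 0 | exists 1 => x [_ []]].
pose c := sup S.
have c0 : 0 <= c by apply: ub_le_sup => //; exact: supS.2.
have c1 : c <= 1 by apply: ge_sup => // [|x [_ []] //]; exists 0.
have [d d0 hd] := Pc c c0 c1.
have [s [s0 [s1 Ps]] cds] := sup_adherent d0 supS.
have sc : s <= c by apply: ub_le_sup => //; exact: supS.2.
pose t := Num.min 1 (c + d / 2).
have ct : c <= t by rewrite le_min c1 /=; lra.
have t1 : t <= 1 by rewrite ge_min lexx.
have td : t < c + d by rewrite gt_min; apply/orP; right; lra.
have Pt : P t by exact: hd s0 sc ct t1 cds td Ps.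
have : t <= c by apply: ub_le_sup; [exact: supS.2|split; [lra|split]].
rewrite /t; have [h|h] := leP 1 (c + d / 2); last lra.
by move=> _; move: Pt; rewrite /t min_l.
Qed.

(** With lists in place of indexed families, an induction can add one interval at a time. *)
Lemma abs_cont01_seq f : abs_cont01 f -> forall e, 0 < e ->
  exists2 d, 0 < d & forall l : seq (R * R),
    all (fun p => [&& 0 <= p.1, p.1 <= p.2 & p.2 <= 1]) l ->
    pairwise (fun p r => (p.2 <= r.1) || (r.2 <= p.1)) l ->
    \sum_(p <- l) (p.2 - p.1) < d ->
    \sum_(p <- l) `|f p.2 - f p.1| < e.
Proof.
move=> acf e e0; have [d d0 hd] := acf e e0; exists d => // l.
move=> /(all_nthP (0, 0)) al /(pairwiseP (0, 0)) pl.
rewrite (big_nth (0, 0)) big_mkord => sl.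
rewrite (big_nth (0, 0)) big_mkord.
apply: (hd (size l) (fun i => (nth (0, 0) l i).1)
  (fun i => (nth (0, 0) l i).2)) => //.
- by move=> k; have /and3P[] := al k (ltn_ord k).
- move=> i j ij; have [lt|lt|/val_inj eq] := ltngtP i j.
  + by have /orP := pl i j (ltn_ord i) (ltn_ord j) lt.
  + by have /orP[] := pl j i (ltn_ord j) (ltn_ord i) lt; [right|left].
  + by rewrite eq eqxx in ij.
Qed.

(** The difference quotients at [c] exceed [- e] on both sides; the two resulting estimates are
    added. Both require intervals that contain [c]. *)
Lemma derive_ge0_straddle f c e : derivable f c 1 -> 0 <= derive1 f c -> 0 < e ->
  exists2 d, 0 < d & forall s t, s <= c -> c <= t -> c - d < s -> t < c + d ->
    f s <= f t + e * (t - s).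
Proof.
move=> df f'0 e0.
have f'E : (fun h => h^-1 *: (f (h *: 1 + c) - f c)) @ 0^' --> derive1 f c.
  by rewrite derive1E; exact: df.
have : \forall h \near 0^', - e < h^-1 *: (f (h *: 1 + c) - f c).
  by apply: (cvgr_gt _ f'E); rewrite (lt_le_trans _ f'0) // oppr_lt0.
rewrite near_withinE near_simpl => -[d /= d0 hd].
have up t : t != c -> `|t - c| < d -> - e < (t - c)^-1 * (f t - f c).
  move=> tc td; have := hd (t - c).
  rewrite /ball_ /= sub0r normrN subr_eq0 => /(_ td tc).
  by rewrite /GRing.scale /= mulr1 subrK.
exists d => // s t sc ct sd td.
have ft : f c - e * (t - c) <= f t.
  have [<-|tc] := eqVneq t c; first by rewrite subrr mulr0 subr0.
  have tc0 : 0 < t - c by rewrite subr_gt0 lt_neqAle eq_sym tc.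
  have := up t tc; rewrite gtr0_norm // mulrC ltr_pdivlMr // => /(_ _); lra.
have fs : f s <= f c + e * (c - s).
  have [<-|tc] := eqVneq s c; first by rewrite subrr mulr0 addr0.
  have tc0 : s - c < 0 by rewrite subr_lt0 lt_neqAle tc.
  have := up s tc; rewrite ltr0_norm // mulrC ltr_ndivlMr // => /(_ _); lra.
lra.
Qed.

(* Intervals straddling a point of the exceptional set are collected in the list
   [l]; absolute continuity bounds the total variation over them, since they lie
   in an open set of small measure. *)
Lemma abs_cont01_le f : abs_cont01 f ->
  {ae mu, forall s, 0 < s < 1 -> derivable f s 1 /\ 0 <= derive1 f s} ->
  f 0 <= f 1.
Proof.
move=> acf [N0 [mN0 N00 sN0]].
(* The endpoints join the exceptional set, as the hypothesis covers only the open interval. *)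
pose N : set R := N0 `|` [set 0] `|` [set 1].
have m1 (x : R) : measurable [set x] by exact: measurable_set1.
have mN1 : measurable (N0 `|` [set 0]) by exact: measurableU.
have mN : measurable N by exact: measurableU.
have muN : mu N = 0%E.
  have z x : mu [set x] = 0%E by exact: lebesgue_measure_set1.
  by rewrite /N measureU0 //; [rewrite measureU0 //|]; exact: z.
have dN s : 0 <= s -> s <= 1 -> ~ N s -> derivable f s 1 /\ 0 <= derive1 f s.
  move=> s0 s1 Ns.
  have Ns0 : s <> 0 by move=> E; apply: Ns; left; right.
  have Ns1 : s <> 1 by move=> E; apply: Ns; right.
  have s01 : 0 < s < 1 by rewrite !lt_neqAle eq_sym; do ! (apply/andP; split) => //; apply/eqP.
  by apply: contrapT => h; apply: Ns; left; left; apply: sN0 => /= /(_ s01).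
apply/ler_addgt0Pr => e e0.
have e2 : 0 < e / 2 by lra.
have [d d0 hd] := abs_cont01_seq acf e2.
have muNoo : (mu N < +oo)%E by rewrite muN.
have [V [oV NV mV]] := lebesgue_regularity_outer mN muNoo d0.
have mesV : measurable V by exact: open_measurable.
have muV : (mu V < d%:E)%E.
  by rewrite -(setDUK NV) setUC measureU0 //; exact: measurableD.
(* The length budget available up to [s]. The half-open interval makes it additive when [s]
   grows. *)
pose m s := mu (V `&` `[0, s[).
have mfin s : m s \is a fin_num.
  rewrite ge0_fin_numE //; apply: le_lt_trans (ltry d).
  apply: le_trans (ltW muV); apply: le_measure; rewrite ?inE //.
  exact: measurableI.
(* Invariant: up to [s], the decrease of [f] is at most [e / 2 * s] plus its variation over disjoint
   intervals whose total length is within the budget [m s]. *)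
pose P s := exists l : seq (R * R), [/\
  all (fun p => [&& 0 <= p.1, p.1 <= p.2 & p.2 <= s]) l,
  pairwise (fun p r => (p.2 <= r.1) || (r.2 <= p.1)) l,
  ((\sum_(p <- l) (p.2 - p.1))%:E <= m s)%E &
  f 0 <= f s + e / 2 * s + \sum_(p <- l) `|f p.2 - f p.1|].
have : P 1.
  apply: real_induction01.
    exists nil; split => //; first by rewrite big_nil measure_ge0.
    by rewrite big_nil mulr0 !addr0.
  move=> c c0 c1; have [Nc|Nc] := pselect (N c).
    (* Exceptional [c]: the interval from [s] to [t] lies in [V] and is added to the list; the
       growth of [m] pays for its length. *)
    have [r /= r0 hr] : nbhs c V by apply: open_nbhs_nbhs; split => //; exact: NV.
    exists r => // s t s0 sc ct t1 cs tc [l [al pl sl fl]].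
    exists ((s, t) :: l); split => /=.
    - rewrite s0 lexx (le_trans sc ct) /=.
      apply: sub_all al => p /and3P[-> -> /=] h; lra.
    - rewrite pl andbT; apply/allP => p /(allP al) /and3P[_ _ ->].
      by rewrite orbT.
    - rewrite big_cons /= EFinD addeC.
      apply: (@le_trans _ _ (m s + mu `[s, t[)%E).
        apply: leeD => //; rewrite lebesgue_measure_itv /= lte_fin.
        have [st|st] := ltP s t; first by rewrite -EFinD.
        by rewrite lee_fin; lra.
      rewrite /m -measureU //; first apply: le_measure; rewrite ?inE //.
      + by apply: measurableU => //; exact: measurableI.
      + exact: measurableI.
      + move=> x [[Vx]|] /=; rewrite !in_itv /=.
          by move=> /andP[-> h]; split => //=; lra.
        move=> /andP[h1 h2]; split; last by apply/andP; split; lra.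
        by apply: hr; rewrite /ball_ /= ltr_norml; apply/andP; split; lra.
      + exact: measurableI.
      + apply/seteqP; split => // x [[_]] /=; rewrite !in_itv /=.
        by move=> /andP[_ h1] /andP[h2 _]; move: h1; rewrite ltNge h2.
    - rewrite big_cons /=.
      have := ler_norm (f s - f t); rewrite distrC.
      have : e / 2 * s <= e / 2 * t by rewrite ler_wpM2l //; lra.
      lra.
  (* Regular [c]: the derivative estimate pays with slope [e / 2], and the list is unchanged. *)
  have [df f'0] := dN c c0 c1 Nc.
  have [r r0 hr] := derive_ge0_straddle df f'0 e2.
  exists r => // s t s0 sc ct t1 cs tc [l [al pl sl fl]].
  exists l; split => //.
  - by apply: sub_all al => p /and3P[-> -> /=] h; lra.
  - apply: le_trans sl _; apply: le_measure; rewrite ?inE; try exact: measurableI.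
    by apply: setIS => x /=; rewrite !in_itv /= => /andP[-> h]; lra.
  - have := hr s t sc ct cs tc; lra.
move=> [l [al pl sl fl]].
(* The budget is below [d], so the listed variation is below [e / 2] and the total loss below
   [e]. *)
have := hd l al pl; rewrite -lte_fin => /(_ (le_lt_trans sl _)) h.
suff /h : (m 1%R < d%:E)%E by move: fl; lra.
apply: le_lt_trans muV; apply: le_measure; rewrite ?inE //.
exact: measurableI.
Qed.
End AbsolutelyContinuous.

(** * Closure properties of absolute continuity *)

Section AbsolutelyContinuousCalculus.
Variable R : realType.
Implicit Types (f g : R -> R) (s t : R).
Notation mu := (@lebesgue_measure R).

Lemma abs_cont01_pt f : abs_cont01 f -> forall e, 0 < e ->
  exists2 d, 0 < d & forall s t, 0 <= s -> s <= t -> t <= 1 -> t - s < d ->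
    `|f t - f s| < e.
Proof.
move=> acf e e0; have [d d0 hd] := acf e e0; exists d => // s t s0 st t1 std.
have := hd 1%N (fun=> s) (fun=> t); rewrite !big_ord1; apply => //.
by move=> k l; rewrite !ord1 eqxx.
Qed.

(** The common source of the rules for sums, products and compositions: each bounds an increment by
    increments of functions already treated. *)
Lemma abs_cont01_dominated K f g h : 0 < K -> abs_cont01 f -> abs_cont01 g ->
  (forall s t, 0 <= s -> s <= t -> t <= 1 ->
     `|h t - h s| <= K * (`|f t - f s| + `|g t - g s|)) ->
  abs_cont01 h.
Proof.
move=> K0 acf acg hK e e0.
have e'0 : 0 < e / K / 2 by rewrite !divr_gt0.
have [d1 d10 h1] := acf _ e'0; have [d2 d20 h2] := acg _ e'0.
exists (Num.min d1 d2); first by rewrite lt_min d10.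
move=> n a b hab disj; rewrite lt_min => /andP[s1 s2].
have := h1 n a b hab disj s1; have := h2 n a b hab disj s2.
move=> S2 S1.
apply: (@le_lt_trans _ _ (K * (\sum_(k < n) `|f (b k) - f (a k)| +
   \sum_(k < n) `|g (b k) - g (a k)|))).
  rewrite -big_split mulr_sumr; apply: ler_sum => k _.
  by have [? [? ?]] := hab k; exact: hK.
rewrite mulrC -ltr_pdivlMr //; lra.
Qed.

Lemma abs_cont01_cst (c : R) : abs_cont01 (fun=> c).
Proof.
move=> e e0; exists 1 => // n a b _ _ _.
by rewrite big1 // => k _; rewrite subrr normr0.
Qed.

Lemma abs_cont01D f g : abs_cont01 f -> abs_cont01 g ->
  abs_cont01 (fun s => f s + g s).
Proof.
move=> acf acg; apply: (abs_cont01_dominated ltr01 acf acg) => s t _ _ _.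
by rewrite mul1r opprD addrACA ler_normD.
Qed.

Lemma abs_cont01_sum n (F : 'I_n -> R -> R) : (forall k, abs_cont01 (F k)) ->
  abs_cont01 (fun s => \sum_(k < n) F k s).
Proof.
move=> acF; elim: n F acF => [|n IH] F acF.
  rewrite (_ : (fun s => _) = fun=> 0); first exact: abs_cont01_cst.
  by apply/funext => s; rewrite big_ord0.
rewrite (_ : (fun s => _) =
    fun s => F ord0 s + \sum_(k < n) F (lift ord0 k) s); last first.
  by apply/funext => s; rewrite big_ord_recl.
by apply: abs_cont01D => //; exact: IH.
Qed.

Lemma abs_cont01_bounded f : abs_cont01 f ->
  exists2 M, 0 < M & forall s, 0 <= s -> s <= 1 -> `|f s| <= M.
Proof.
move=> acf; have [d d0 hd] := abs_cont01_pt acf ltr01.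
pose P s := exists2 M, 0 < M & forall t, 0 <= t -> t <= s -> `|f t| <= M.
suff : P 1 by [].
apply: real_induction01.
  exists (`|f 0| + 1); first by rewrite ltr_pwDr.
  move=> t t0 t0'; have -> : t = 0 by lra.
  by rewrite lerDl.
(* Half of [d], because [s] and [t] lie on opposite sides of [c] and must be within [d] of each
   other. *)
move=> c c0 c1; exists (d / 2); first lra.
move=> s t s0 sc ct t1 cs tc [M M0 hM].
exists (M + 1); first lra.
move=> r r0 rt; have [rs|rs] := leP r s; first by have := hM r r0 rs; lra.
have h : `|f r - f s| < 1 by apply: hd; lra.
have := hM s s0 (lexx s); have := ler_normD (f r - f s) (f s).
rewrite subrK; lra.
Qed.

Lemma abs_cont01M f g : abs_cont01 f -> abs_cont01 g ->
  abs_cont01 (fun s => f s * g s).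
Proof.
move=> acf acg; have [M M0 hM] := abs_cont01_bounded acf.
have [M' M'0 hM'] := abs_cont01_bounded acg.
apply: (@abs_cont01_dominated (M + M') f g); rewrite ?addr_gt0 //.
move=> s t s0 st t1.
have -> : f t * g t - f s * g s = (f t - f s) * g t + f s * (g t - g s) by ring.
apply: le_trans (ler_normD _ _) _; rewrite !normrM.
have h1 := hM s s0 (le_trans st t1); have h2 := hM' t (le_trans s0 st) t1.
have : `|f t - f s| * `|g t| <= `|f t - f s| * M' by rewrite ler_wpM2l.
have : `|f s| * `|g t - g s| <= M * `|g t - g s| by rewrite ler_wpM2r.
have : 0 <= M * `|f t - f s| by rewrite mulr_ge0 // ltW.
have : 0 <= M' * `|g t - g s| by rewrite mulr_ge0 // ltW.
rewrite mulrDl !mulrDr (mulrC M'); lra.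
Qed.

Lemma abs_cont01Z (c : R) f : abs_cont01 f -> abs_cont01 (fun s => c * f s).
Proof. by move=> acf; apply: abs_cont01M => //; exact: abs_cont01_cst. Qed.

Lemma abs_cont01B f g : abs_cont01 f -> abs_cont01 g ->
  abs_cont01 (fun s => f s - g s).
Proof.
move=> acf acg; rewrite (_ : (fun s => _) = fun s => f s + (-1) * g s).
  by apply: abs_cont01D => //; exact: abs_cont01Z.
by apply/funext => s; rewrite mulN1r.
Qed.

(** By the mean value theorem [c] is Lipschitz on the range of [f]. *)
Lemma abs_cont01_comp (c dc : R -> R) (p r : R) f : abs_cont01 f ->
  (forall s, 0 <= s -> s <= 1 -> p <= f s <= r) ->
  (forall u, p <= u <= r -> is_derive u 1 c (dc u)) ->
  (exists M, forall u, p <= u <= r -> `|dc u| <= M) ->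
  abs_cont01 (c \o f).
Proof.
move=> acf fpr dcE [M hM].
have lip u v : p <= u -> u <= v -> v <= r -> `|c v - c u| <= M * (v - u).
  move=> pu uv vr.
  have dcE' x : x \in `[u, v]%R -> is_derive x 1 c (dc x).
    by rewrite in_itv /= => /andP[ux xv]; apply: dcE; apply/andP; split; lra.
  have cc : {within `[u, v], continuous c}.
    apply: derivable_within_continuous => x xuv.
    by have := dcE' x xuv => -[].
  have dcoo x : x \in `]u, v[%R -> is_derive x 1 c (dc x).
    by move=> xuv; apply: dcE'; exact: subset_itv_oo_cc.
  have [w] := @MVT_segment R c dc u v uv dcoo cc.
  rewrite in_itv /= => /andP[uw wv] ->; rewrite normrM (ger0_norm (_ : 0 <= v - u)).
    by rewrite ler_wpM2r ?subr_ge0 // hM //; apply/andP; split; lra.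
  lra.
(* The maximum with 1 makes the Lipschitz constant strictly positive. *)
have M1 : M <= Num.max 1 M by rewrite le_max lexx orbT.
apply: (@abs_cont01_dominated (Num.max 1 M) f f) => //.
  by rewrite lt_max ltr01.
move=> s t s0 st t1 /=.
have /andP[ps rs] := fpr s s0 (le_trans st t1).
have /andP[pt rt] := fpr t (le_trans s0 st) t1.
have : `|c (f t) - c (f s)| <= M * `|f t - f s|.
  have [fst|/ltW fts] := leP (f s) (f t).
    by rewrite (ger0_norm (_ : 0 <= f t - f s)) ?subr_ge0 //; exact: lip.
  rewrite distrC (distrC (f t)) (ger0_norm (_ : 0 <= f s - f t)) ?subr_ge0 //.
  exact: lip.
have : M * `|f t - f s| <= Num.max 1 M * `|f t - f s| by rewrite ler_wpM2r.
have : 0 <= Num.max 1 M * `|f t - f s|.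
  by rewrite mulr_ge0 // (le_trans ler01) // le_max lexx.
lra.
Qed.

End AbsolutelyContinuousCalculus.

(** * Arc length as an absolutely continuous function *)

Section ArcLength.
Variable R : realType.
Implicit Types (f g : R -> R) (s t : R).
Notation mu := (@lebesgue_measure R).

(** The integral of a nonnegative function is a supremum over simple functions below it, hence
    monotone without measurability. The integrand of [curve_length] is not known to be measurable on
    the null set where the curve may fail to be differentiable. *)
Lemma ge0_le_integral_nonmeasurable (D : set R) (f g : R -> \bar R) :
  (forall x, D x -> 0 <= f x)%E -> (forall x, D x -> f x <= g x)%E ->
  (\int[mu]_(x in D) f x <= \int[mu]_(x in D) g x)%E.
Proof.
move=> f0 fg; rewrite integral_mkcond [leRHS]integral_mkcond.
have f0' x : (0 <= (f \_ D) x)%E.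
  by rewrite /patch; case: ifPn => // /set_mem; exact: f0.
have fg' x : ((f \_ D) x <= (g \_ D) x)%E.
  by rewrite /patch; case: ifPn => // /set_mem; exact: fg.
rewrite !ge0_integralTE //; last by move=> x; exact: le_trans (f0' x) (fg' x).
apply: le_ereal_sup => _ [h hf <-]; exists h => // x.
exact: le_trans (hf x) (fg' x).
Qed.

(** [F] is the integral of [f] up to [y]. It inherits absolute continuity from that of the integral,
    and its derivative is given by Lebesgue differentiation. *)
Lemma Rintegral_abs_cont01 f : (forall s, 0 <= f s) ->
  mu.-integrable setT (EFin \o f) ->
  exists F : R -> R, [/\ abs_cont01 F,
    (forall s, 0 <= F s), (forall s t, s <= t -> F s <= F t),
    {ae mu, forall s, derivable F s 1 /\ derive1 F s = f s} &
    ((F 1)%:E <= \int[mu]_s (f s)%:E)%E].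
Proof.
move=> f0 intf.
have intS (D : set R) : measurable D -> mu.-integrable D (EFin \o f).
  by move=> mD; apply: integrableS intf.
pose F y := (\int[mu]_(t in `]-oo, y]) f t)%R.
have F0 y : 0 <= F y by apply: Rintegral_ge0.
have FE a b : a <= b -> F b - F a = (\int[mu]_(t in `]a, b]) f t)%R.
  by move=> ab; rewrite /F Rintegral_itvB //; exact: intS.
exists F; split => //.
- move=> e e0; have [d [d0 hd]] := integral_normr_continuous intf e0.
  exists d => // n a b hab disj sd.
  (* Half-open intervals stay disjoint when neighbours share an endpoint. *)
  pose A k := `]a k, b k]%classic : set R.
  have mA k : measurable (A k) by exact: measurable_itv.
  have tA : trivIset setT A.
    move=> i j _ _ [x []]; rewrite /A /= !in_itv /= => /andP[h1 h2] /andP[h3 h4].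
    apply: contrapT => /eqP ij; have [h|h] := disj i j ij.
      by have := lt_le_trans h3 (le_trans h2 h); rewrite ltxx.
    by have := lt_le_trans h1 (le_trans h4 h); rewrite ltxx.
  have mU : measurable (\big[setU/set0]_(k < n) A k).
    by apply: bigsetU_measurable.
  have muA : (mu (\big[setU/set0]_(k < n) A k) < d%:E)%E.
    rewrite measure_bigsetU_ord //.
    rewrite (eq_bigr (fun k => (b k - a k)%:E)) ?sumEFin //.
    move=> k _; apply: etrans (lebesgue_measure_itv `]a k, b k]) _.
    rewrite /= lte_fin.
    have [_ [ab _]] := hab k.
    have [//|ba] := ltP (a k) (b k).
    by congr EFin; lra.
  apply: le_lt_trans (hd _ mU muA).
  under [leRHS]eq_Rintegral do rewrite ger0_norm //.
  rewrite le_eqVlt; apply/orP; left; apply/eqP.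
  rewrite /Rintegral ge0_integral_bigsetU //=.
  + rewrite (eq_bigr (fun k => (F (b k) - F (a k))%:E)) ?sumEFin /=.
      apply: eq_bigr => k _; have [_ [ab _]] := hab k.
      by rewrite ger0_norm // FE // Rintegral_ge0.
    move=> k _; have [_ [ab _]] := hab k.
    rewrite FE // /Rintegral fineK; first by [].
    by apply: integrable_fin_num; [|exact: intS].
  + exact: index_enum_uniq.
  + exact: sub_trivIset tA.
  + exact: measurable_int (intS _ mU).
  + by move=> x _; rewrite lee_fin.
- move=> s t st; rewrite -subr_ge0 FE //; exact: Rintegral_ge0.
- apply: FTC1Ny.
    by move=> y; apply: intS.
  have := integrable_locally measurableT (intS _ measurableT).
  by rewrite patch_setT.
- rewrite /F /Rintegral fineK; last by apply: integrable_fin_num (intS _ _).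
  apply: ge0_subset_integral => //.
    exact: measurable_int intf.
  by move=> x _; rewrite lee_fin.
Qed.

Lemma derive1_cvg_harmonic f s : derivable f s 1 ->
  (fun n => n.+1%:R * (f (s + n.+1%:R^-1) - f s)) @ \oo --> derive1 f s.
Proof.
move=> df.
have f'E : (fun h => h^-1 *: (f (h *: 1 + s) - f s)) @ 0^' --> derive1 f s.
  by rewrite derive1E; exact: df.
have h0 : (fun n => n.+1%:R^-1 : R) @ \oo --> (0 : R)^'.
  move=> B nB; have nB' : nbhs (0 : R) (fun h => h != 0 -> B h) by exact: nB.
  have H : \forall n \near \oo, n.+1%:R^-1 != 0 :> R -> B n.+1%:R^-1.
    exact: (@cvg_harmonic R) nB'.
  change (\forall n \near \oo, B n.+1%:R^-1).
  apply: filterS H => n; apply.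
  by rewrite invr_eq0 pnatr_eq0.
have := cvg_comp _ _ h0 f'E; apply: cvg_trans; apply: near_eq_cvg.
by near=> n; rewrite /= invrK /GRing.scale /= mulr1 (addrC s).
Unshelve. all: by end_near. Qed.

(** The derivative is a pointwise limit of difference quotients with steps [1 / (n + 1)], which are
    measurable once [f] is extended continuously to the line. *)
Lemma measurable_derive1 f (D : set R) : abs_cont01 f ->
  measurable D -> D `<=` `]0, 1[%classic -> (forall s, D s -> derivable f s 1) ->
  measurable_fun D (derive1 f).
Proof.
move=> acf mD D01 dfD.
(* [f] is controlled only on [0, 1]; composing with the projection onto this interval extends it by
   constants. *)
pose clamp s : R := Num.max 0 (Num.min 1 s).
have c0 s : 0 <= clamp s by rewrite /clamp le_max lexx.
have c1 s : clamp s <= 1 by rewrite /clamp ge_max ler01 ge_min lexx.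
have cid s : 0 <= s -> s <= 1 -> clamp s = s.
  by move=> s0 s1; rewrite /clamp min_r // max_r.
have clip s t : s <= t -> clamp s <= clamp t /\ clamp t - clamp s <= t - s.
  rewrite /clamp => st.
  by have [h|h] := leP 1 s; have [h'|h'] := leP 1 t; split;
    rewrite ?(max_r ler01) //; try (have [?|?] := leP 0 s);
    try (have [?|?] := leP 0 t); lra.
pose X s := f (clamp s).
have cX : continuous X.
  move=> s; apply/cvgrPdist_lt => e e0.
  have [d d0 hd] := abs_cont01_pt acf e0.
  near=> t; rewrite /X.
  have std : `|s - t| < d by near: t; exact: cvgr_dist_lt.
  have [st|/ltW ts] := leP s t.
    have [h1 h2] := clip s t st.
    by rewrite distrC; apply: hd => //; move: std; rewrite distrC ger0_norm; lra.
  have [h1 h2] := clip t s ts.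
  by apply: hd => //; move: std; rewrite ger0_norm; lra.
have mX : measurable_fun setT X by exact: continuous_measurable_fun.
pose h n s := n.+1%:R * (X (s + n.+1%:R^-1) - X s).
apply: (@measurable_fun_cvg _ _ _ D h) => [n|s Ds].
  apply: measurable_funTS; apply: measurable_funM => //.
  have mS : measurable_fun setT (fun s : R => s + n.+1%:R^-1).
    exact: measurable_funD.
  by apply: measurable_funB => //; exact: (measurableT_comp mX mS).
have /= := D01 s Ds; rewrite in_itv /= => /andP[s0 s1].
have := derive1_cvg_harmonic (dfD s Ds).
(* For large [n] both points of the quotient lie in [0, 1], where the extension agrees with [f]. *)
apply: cvg_trans; apply: near_eq_cvg; near=> n.
have ns : n.+1%:R^-1 < 1 - s.
  by near: n; apply: (cvgr_lt _ (@cvg_harmonic R)); rewrite subr_gt0.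
have n0 : 0 < n.+1%:R^-1 :> R by rewrite invr_gt0.
have e0 : 0 <= s + n.+1%:R^-1 by rewrite addr_ge0 // ltW.
have e1 : s + n.+1%:R^-1 <= 1 by rewrite -lerBrDl ltW.
by rewrite /h /X (cid _ e0 e1) (cid _ (ltW s0) (ltW s1)).
Unshelve. all: by end_near. Qed.

Lemma arc_length_exists q (xs : 'I_q -> R -> R) :
  let g s := Num.sqrt (\sum_(l < q) derive1 (xs l) s ^+ 2) in
  (forall l, abs_cont01 (xs l)) ->
  {ae mu, forall s, `[0, 1]%classic s -> forall l, derivable (xs l) s 1} ->
  (curve_length xs < +oo)%E ->
  exists F : R -> R, [/\ abs_cont01 F,
    (forall s, 0 <= F s), (forall s t, s <= t -> F s <= F t),
    {ae mu, forall s, 0 < s < 1 -> derivable F s 1 /\ derive1 F s = g s} &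
    ((F 1)%:E <= curve_length xs)%E].
Proof.
move=> g acx [N [mN N0 sN]] Loo.
pose D : set R := `]0, 1[%classic `\` N.
have mD : measurable D by apply: measurableD => //; exact: measurable_itv.
have D01 : D `<=` `]0, 1[%classic by move=> s [].
have dD l s : D s -> derivable (xs l) s 1.
  move=> [s01 Ns]; apply: contrapT => h; apply: Ns; apply: sN => /= H.
  by apply: h; apply: H; exact: subset_itv_oo_cc s01.
have mg : measurable_fun D g.
  have msqrt : measurable_fun setT (@Num.sqrt R).
    by apply: continuous_measurable_fun; exact: sqrt_continuous.
  apply: (measurableT_comp msqrt).
  apply: measurable_sum => l; apply: measurable_funX.
  by apply: measurable_derive1 => // s; exact: dD.
(* The speed is set to zero off the good set, which makes it measurable on the line and keeps its
   integral below the length. *)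
pose f := g \_ D.
have g0 s : 0 <= g s by exact: sqrtr_ge0.
have f0 s : 0 <= f s by rewrite /f /patch; case: ifP.
have mf : measurable_fun setT f by apply/(measurable_restrictT _ _).1.
have fL : (\int[mu]_s (f s)%:E <= curve_length xs)%E.
  have -> : (\int[mu]_s (f s)%:E = \int[mu]_(s in `[0%R, 1%R]) (f s)%:E)%E.
    rewrite [RHS]integral_mkcond; apply: eq_integral => s _.
    rewrite [in RHS]/patch; case: ifPn => // s01.
    rewrite /f /patch ifF //; apply: contraNF s01 => /set_mem Ds.
    by rewrite inE; apply: subset_itv_oo_cc; exact: D01.
  apply: ge0_le_integral_nonmeasurable => s _; rewrite lee_fin //.
  by rewrite /f /patch; case: ifP => _; [exact: lexx|exact: sqrtr_ge0].
have intf : mu.-integrable setT (EFin \o f).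
  apply/integrableP; split; first exact/measurable_EFinP.
  apply: le_lt_trans Loo; apply: le_trans fL.
  by under eq_integral do rewrite /= ger0_norm //.
have [F [acF F0 mF dF F1]] := Rintegral_abs_cont01 f0 intf.
exists F; split => //; last exact: le_trans F1 fL.
have aeN : {ae mu, forall s, ~ N s}.
  by exists N; split => // s /= /contrapT.
have FF := ae_filter_ringOfSetsType mu.
apply: (filterS2 FF _ aeN dF) => s Ns [dFs F's] s01; split => //.
rewrite F's /f /patch ifT // inE; split => //=.
Qed.

End ArcLength.

(** * The Riccati equation for the scaled cotangent *)

Section Riccati.
Variable R : realType.
Implicit Types (f g : R -> R) (s t u lam : R).

Lemma is_derive1D f g s a b : is_derive s 1 f a -> is_derive s 1 g b ->
  is_derive s 1 (fun x => f x + g x) (a + b).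
Proof. by move=> fa gb; exact: is_deriveD. Qed.

Lemma is_derive1M f g s a b : is_derive s 1 f a -> is_derive s 1 g b ->
  is_derive s 1 (fun x => f x * g x) (a * g s + f s * b).
Proof.
move=> fa gb; have h := is_deriveM fa gb; apply: (is_derive_eq h).
by rewrite /GRing.scale /= addrC (mulrC a).
Qed.

Lemma is_derive1_sum n (F : 'I_n -> R -> R) s (dF : 'I_n -> R) :
  (forall k, is_derive s 1 (F k) (dF k)) ->
  is_derive s 1 (fun x => \sum_(k < n) F k x) (\sum_(k < n) dF k).
Proof.
move=> FdF; rewrite (_ : (fun x => _) = \sum_(k < n) F k).
  exact: is_derive_sum.
by apply/funext => x; rewrite fct_sumE.
Qed.

Lemma is_derive1Z f s c a : is_derive s 1 f a ->
  is_derive s 1 (fun x => c * f x) (c * a).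
Proof.
move=> fa; have h := is_derive1M (is_derive_cst c s 1) fa.
apply: (is_derive_eq h).
by rewrite mul0r add0r.
Qed.

(** The value for [lam = 0] is the limit of [lam cot(lam u)] as [lam] tends to 0. *)
Definition cotl lam u : R :=
  if lam == 0 then u^-1 else lam * cos (lam * u) / sin (lam * u).

Lemma cotl1 lam : cotl lam 1 = zcotz lam.
Proof. by rewrite /cotl /zcotz invr1 mulr1. Qed.

Lemma sin_neq0 (x : R) : x != 0 -> `|x| < pi -> sin x != 0.
Proof.
move=> x0; rewrite ltr_norml => /andP[h1 h2].
have [xn|xp|xE] := ltgtP x 0.
- rewrite -oppr_eq0 -sinN gt_eqF // sin_gt0_pi //; apply/andP; split; lra.
- by rewrite gt_eqF // sin_gt0_pi // xp.
- by rewrite xE eqxx in x0.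
Qed.

Lemma is_derive_cotl lam u : `|lam| < pi -> 0 < u -> u <= 1 ->
  is_derive u 1 (cotl lam) (- (lam ^+ 2 + cotl lam u ^+ 2)).
Proof.
move=> lampi u0 u1; rewrite /cotl; have [->|lam0] := eqVneq lam 0.
  have u_neq0 : u != 0 by rewrite gt_eqF.
  have h := is_deriveV u_neq0 (is_derive_id u 1); apply: (is_derive_eq h).
  by rewrite /GRing.scale /= mulr1 expr0n add0r exprVn.
(* The bound [|lam| < pi] enters here: no pole occurs for [0 < u <= 1]. *)
have s0 : sin (lam * u) != 0.
  apply: sin_neq0; first by rewrite mulf_neq0 // gt_eqF.
  rewrite normrM (gtr0_norm u0); apply: le_lt_trans lampi.
  by rewrite ler_piMr.
have dl : is_derive u 1 (fun x => lam * x) lam.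
  by have := is_derive1Z lam (is_derive_id u 1); rewrite mulr1.
have ds : is_derive u 1 (fun x => sin (lam * x)) (lam * cos (lam * u)).
  have h := is_derive1_comp (is_derive_sin _) dl; apply: (is_derive_eq h).
  by rewrite mulrC.
have dc : is_derive u 1 (fun x => cos (lam * x)) (lam * - sin (lam * u)).
  have h := is_derive1_comp (is_derive_cos _) dl; apply: (is_derive_eq h).
  by rewrite mulrC.
have h := is_derive1M (is_derive1Z lam dc) (is_deriveV s0 ds).
apply: (is_derive_eq h).
by rewrite /GRing.scale /=; field.
Qed.

(** On a compact interval away from 0, [cotl] lies between its extreme values, so its square is at
    most the sum of their squares. *)
Lemma cotl_bounded lam p : `|lam| < pi -> 0 < p -> p <= 1 ->
  exists M, forall u, p <= u <= 1 -> `|- (lam ^+ 2 + cotl lam u ^+ 2)| <= M.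
Proof.
move=> lampi p0 p1.
have cc : {within `[p, 1], continuous (cotl lam)}.
  apply: derivable_within_continuous => x; rewrite in_itv /= => /andP[px x1].
  by have [] := is_derive_cotl lampi (lt_le_trans p0 px) x1.
have [a _ ha] := EVT_max p1 cc; have [b _ hb] := EVT_min p1 cc.
exists (lam ^+ 2 + (cotl lam a ^+ 2 + cotl lam b ^+ 2)) => u pu.
have /ha cu := pu; have /hb uc := pu.
rewrite normrN ger0_norm ?addr_ge0 ?sqr_ge0 // lerD2l.
have [c0|c0] := leP 0 (cotl lam u).
  by rewrite ler_wpDr ?sqr_ge0 // ler_sqr ?nnegrE //; lra.
by rewrite ler_wpDl ?sqr_ge0 // -sqrrN -[leRHS]sqrrN ler_sqr ?nnegrE //; lra.
Qed.

(* The difference of the two sides is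
   [|a (c - i lam) (x + i y) - (x' + i y')|^2 / a]. *)
Lemma riccati_ineq (a c lam x y x' y' : R) : 0 < a ->
  2 * c * (x * x' + y * y') + 2 * lam * (x' * y - y' * x) <=
  a * (lam ^+ 2 + c ^+ 2) * (x ^+ 2 + y ^+ 2) + (x' ^+ 2 + y' ^+ 2) / a.
Proof.
move=> a0; rewrite -subr_ge0.
set E := (X in 0 <= X).
have -> : E = ((a * (c * x + lam * y) - x') ^+ 2 + (a * (c * y - lam * x) - y') ^+ 2) / a.
  rewrite /E; field; lra.
by rewrite divr_ge0 ?addr_ge0 ?sqr_ge0 // ltW.
Qed.
End Riccati.

(** * The calibration along one horizontal curve *)

Section Calibration.
Variable R : realType.
Notation mu := (@lebesgue_measure R).

Lemma is_derive_derive1 (f : R -> R) s : derivable f s 1 ->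
  is_derive s 1 f (derive1 f s).
Proof. by move=> df; rewrite derive1E; exact: derivableP. Qed.

(** With [v] the position and [w] the velocity, horizontality turns [tau . t'] into the left side,
    so the vertical motion is governed by the skew form of the diagonalized matrix. *)
Lemma horizontal_vertical_rate q m (U : 'I_m -> 'M[R]_q) (tau : 'cV[R]_m)
    (v w : 'cV[R]_q) :
  \sum_(j < m) tau j 0 *
    (2^-1 * \sum_(l < q) (\sum_(k < q) U j l k * v k 0) * w l 0) =
  2^-1 * (w^T *m (\sum_(j < m) tau j 0 *: U j) *m v) 0 0.
Proof.
rewrite mulmx_sumr mulmx_suml summxE mulr_sumr; apply: eq_bigr => j _.
rewrite -scalemxAr -scalemxAl mxE -mulmxA mulrCA; congr (_ * (_ * _)).
rewrite mxE; apply: eq_bigr => l _; rewrite !mxE mulrC; congr (_ * _).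
Qed.

Lemma phi_le_arc_length q m (U : 'I_m -> 'M[R]_q) (x : 'cV[R]_q)
    (t tau : 'cV[R]_m) xs ts (F : R -> R) :
  (forall j, (U j)^T = - U j) -> Omega_star U tau -> horizontal U xs ts ->
  (forall l, xs l 0 = 0 /\ xs l 1 = x l 0) ->
  (forall j, ts j 0 = 0 /\ ts j 1 = t j 0) ->
  abs_cont01 F -> (forall s, 0 <= F s) -> (forall s r, s <= r -> F s <= F r) ->
  {ae mu, forall s, 0 < s < 1 -> derivable F s 1 /\
     derive1 F s = Num.sqrt (\sum_(l < q) derive1 (xs l) s ^+ 2)} ->
  phi U x t tau <= F 1 ^+ 2.
Proof.
move=> skU Otau [acx [act dxt]] x01 t01 acF F0 mF dF.
pose B := \sum_(j < m) tau j 0 *: U j.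
have skB : B^T = - B.
  rewrite /B raddf_sum -sumrN; apply: eq_bigr => j _ /=.
  by rewrite linearZ /= skU scalerN.
have [lam [a [b [lampi ab_isom ab_B ab_cot]]]] := hermitian_spectral R q B skB.
have {}lampi k : `|lam k| < pi by exact: le_lt_trans (lampi k) Otau.
(* The choice [eps = e / (F 1 + 1)] makes the error [eps * F 1] at most [e]. *)
suff key eps : 0 < eps -> phi U x t tau <= (eps + F 1) * F 1.
  apply/ler_addgt0Pr => e e0.
  have F1 : 0 < F 1 + 1 by rewrite ltr_wpDl.
  apply: le_trans (key (e / (F 1 + 1)) (divr_gt0 e0 F1)) _.
  rewrite mulrDl -expr2 addrC lerD2l -mulrA ler_piMr ?(ltW e0) //.
  by rewrite mulrC ler_pdivrMr // mul1r lerDl.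
move=> eps0; set Lam := eps + F 1.
have Lam0 : 0 < Lam by rewrite ltr_wpDr.
pose u s := (eps + F s) / Lam.
have u0 s : eps / Lam <= u s by rewrite ler_pM2r ?invr_gt0 // lerDl.
have u1 s : s <= 1 -> u s <= 1.
  by move=> s1; rewrite ler_pdivrMr // mul1r lerD2l mF.
have epsLam : 0 < eps / Lam by rewrite divr_gt0.
pose ya k s := \sum_(l < q) a k l * xs l s.
pose yb k s := \sum_(l < q) b k l * xs l s.
pose G s := Lam * F s - 4 * \sum_(j < m) tau j 0 * ts j s
  - \sum_(k < q) cotl (lam k) (u s) * (ya k s * ya k s + yb k s * yb k s).
have acu : abs_cont01 u.
  rewrite /u (_ : (fun s => _) = fun s => Lam^-1 * (eps + F s)).
    by apply: abs_cont01Z; apply: abs_cont01D => //; exact: abs_cont01_cst.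
  by apply/funext => s; rewrite mulrC.
have acya k : abs_cont01 (ya k).
  by apply: abs_cont01_sum => l; exact: abs_cont01Z.
have acyb k : abs_cont01 (yb k).
  by apply: abs_cont01_sum => l; exact: abs_cont01Z.
have acc k : abs_cont01 (fun s => cotl (lam k) (u s)).
  apply: (abs_cont01_comp acu (c := cotl (lam k)) (p := eps / Lam) (r := 1)).
  - by move=> s _ s1; rewrite u0 u1.
  - move=> v /andP[ev v1]; apply: (is_derive_cotl (lampi k) _ v1).
    exact: lt_le_trans ev.
  - apply: cotl_bounded => //.
    by rewrite ler_pdivrMr // mul1r lerDl.
have acG : abs_cont01 G.
  apply: abs_cont01B; first apply: abs_cont01B.
  - exact: abs_cont01Z.
  - by apply: abs_cont01Z; apply: abs_cont01_sum => j; exact: abs_cont01Z.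
  - apply: abs_cont01_sum => k; apply: abs_cont01M => //.
    by apply: abs_cont01D; exact: abs_cont01M.
have G01 : G 0 <= G 1.
  apply: abs_cont01_le => //.
  have FF := ae_filter_ringOfSetsType mu.
  apply: (filterS2 FF _ dxt dF) => s dxs dFs s01.
  have [{}dFs F's] := dFs s01.
  have /andP[s0 s1] := s01.
  have s01' : `[0%R, 1%R]%classic s by rewrite /= in_itv /= (ltW s0) (ltW s1).
  have [{}dxs dts] := dxs s01'.
  set g := Num.sqrt _ in F's.
  pose x' l := derive1 (xs l) s.
  have dFg : is_derive s 1 F g by rewrite -F's; exact: is_derive_derive1.
  have du : is_derive s 1 u (g / Lam).
    rewrite /u (_ : (fun s => _) = fun s => Lam^-1 * (eps + F s)); last first.
      by apply/funext => r; rewrite mulrC.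
    have h := is_derive1Z Lam^-1 (is_derive1D (is_derive_cst eps s 1) dFg).
    by apply: (is_derive_eq h); rewrite add0r mulrC.
  have dy (c : 'M[R]_q) k : is_derive s 1 (fun s => \sum_(l < q) c k l * xs l s)
      (\sum_(l < q) c k l * x' l).
    apply: is_derive1_sum => l; apply: is_derive1Z; exact: is_derive_derive1.
  have dt : is_derive s 1 (fun s => \sum_(j < m) tau j 0 * ts j s)
      (\sum_(j < m) tau j 0 * derive1 (ts j) s).
    apply: is_derive1_sum => j; apply: is_derive1Z.
    by apply: is_derive_derive1; case: (dts j).
  pose c k := cotl (lam k) (u s).
  have dc k : is_derive s 1 (fun s => cotl (lam k) (u s))
      (- (lam k ^+ 2 + c k ^+ 2) * (g / Lam)).
    have dcu := is_derive_cotl (lampi k) (lt_le_trans epsLam (u0 s)) (u1 s (ltW s1)).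
    exact: (is_derive1_comp dcu du).
  pose p k := \sum_(l < q) a k l * x' l.
  pose r k := \sum_(l < q) b k l * x' l.
  pose dG := Lam * g - 4 * \sum_(j < m) tau j 0 * derive1 (ts j) s
    - \sum_(k < q) (- (lam k ^+ 2 + c k ^+ 2) * (g / Lam) *
          (ya k s * ya k s + yb k s * yb k s)
        + c k * ((p k * ya k s + ya k s * p k) + (r k * yb k s + yb k s * r k))).
  have GdG : is_derive s 1 G dG.
    apply: (is_deriveB (is_deriveB (is_derive1Z Lam dFg) (is_derive1Z 4 dt))).
    apply: is_derive1_sum => k; apply: (is_derive1M (dc k)).
    by apply: is_derive1D; apply: is_derive1M; exact: dy.
  split; first by case: GdG.
  rewrite derive1E derive_val /dG.
  pose v : 'cV[R]_q := \col_l xs l s; pose w : 'cV[R]_q := \col_l x' l.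
  have aE k : (a *m v) k 0 = ya k s.
    by rewrite mxE; apply: eq_bigr => l _; rewrite mxE.
  have bE k : (b *m v) k 0 = yb k s.
    by rewrite mxE; apply: eq_bigr => l _; rewrite mxE.
  have pE k : (a *m w) k 0 = p k.
    by rewrite mxE; apply: eq_bigr => l _; rewrite mxE.
  have rE k : (b *m w) k 0 = r k.
    by rewrite mxE; apply: eq_bigr => l _; rewrite mxE.
  (* The vertical term becomes a sum over eigen-coordinates, so that the inequality can be checked
     for each [k]. *)
  have -> : 4 * (\sum_(j < m) tau j 0 * derive1 (ts j) s) =
      \sum_(k < q) 2 * lam k * (p k * yb k s - r k * ya k s).
    rewrite (eq_bigr (fun k => 2 * (lam k * ((a *m w) k 0 * (b *m v) k 0 -
        (b *m w) k 0 * (a *m v) k 0)))); last first.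
      by move=> k _; rewrite aE bE pE rE mulrA.
    rewrite -mulr_sumr -ab_B.
    rewrite (_ : \sum_(j < m) _ = 2^-1 * (w^T *m B *m v) 0 0).
      by field.
    rewrite -horizontal_vertical_rate; apply: eq_bigr => j _.
    rewrite (dts j).2; congr (_ * (_ * _)); apply: eq_bigr => l _.
    by rewrite mxE; congr (_ * _); apply: eq_bigr => k _; rewrite mxE.
  (* The unitary change of basis preserves the speed. *)
  have g2 : \sum_(k < q) (p k ^+ 2 + r k ^+ 2) = g ^+ 2.
    rewrite sqr_sqrtr; last by apply: sumr_ge0 => l _; rewrite sqr_ge0.
    under eq_bigr => k _ do rewrite -pE -rE.
    by rewrite ab_isom; apply: eq_bigr => l _; rewrite mxE.
  rewrite -addrA -opprD -big_split subr_ge0 /=.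
  (* The Riccati inequality divides by [g / Lam]. At zero speed all coordinate velocities vanish and
     both sides are zero. *)
  have [g0|g0] := eqVneq g 0.
    have pr0 k : p k = 0 /\ r k = 0.
      have /eqP : \sum_(k < q) (p k ^+ 2 + r k ^+ 2) = 0 by rewrite g2 g0 expr0n.
      rewrite psumr_eq0; last by move=> i _; rewrite addr_ge0 ?sqr_ge0.
      move=> /allP /(_ k (mem_index_enum k)) /=.
      by rewrite paddr_eq0 ?sqr_ge0 // !sqrf_eq0 => /andP[/eqP -> /eqP ->].
    rewrite g0 mulr0 big1 // => k _; have [-> ->] := pr0 k.
    by ring.
  have gL : 0 < g / Lam by rewrite divr_gt0 // lt_neqAle eq_sym g0 sqrtr_ge0.
  (* [Lam * g] is [g ^+ 2 / (g / Lam)], shared among the coordinates; [g / Lam], the derivative of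
     [u], is the parameter [a] of the Riccati inequality. *)
  have -> : Lam * g = \sum_(k < q) (p k ^+ 2 + r k ^+ 2) / (g / Lam).
    by rewrite -mulr_suml g2; field; rewrite g0 gt_eqF.
  apply: ler_sum => k _.
  have h := riccati_ineq (c k) (lam k) (ya k s) (yb k s) (p k) (r k) gL.
  rewrite -subr_ge0 in h; rewrite -subr_ge0; apply: (le_trans h).
  by rewrite le_eqVlt; apply/orP; left; apply/eqP; ring.
(* The curve starts at the origin, so only [Lam * F 0] survives. *)
have G0 : 0 <= G 0.
  rewrite /G !big1 ?mulr0 ?subr0.
  - by rewrite mulr_ge0 // ltW.
  - move=> k _; rewrite /ya /yb.
    by rewrite !big1 ?mulr0 ?addr0 ?mulr0 // => l _; rewrite (x01 l).1 mulr0.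
  - by move=> j _; rewrite (t01 j).1 mulr0.
have := le_trans G0 G01.
(* At the endpoint [u] equals 1 and [cotl] becomes [zcotz], so the quadratic term is the one in
   [phi]. *)
suff -> : G 1 = Lam * F 1 - phi U x t tau by rewrite subr_ge0.
rewrite /G /phi ab_cot -addrA -opprD; congr (_ - _).
rewrite addrC; congr (_ + _).
  apply: eq_bigr => k _; rewrite /u divff ?gt_eqF // cotl1 -!expr2 !mxE.
  by congr (_ * (_ ^+ 2 + _ ^+ 2)); apply: eq_bigr => l _; rewrite (x01 l).2.
by congr (_ * _); apply: eq_bigr => j _; rewrite (t01 j).2 mulrC.
Qed.
End Calibration.

(** * Passage to the infimum over curves and the supremum over [tau] *)

Unset Implicit Arguments.
Set Strict Implicit.

Theorem theorem2p2 (R : realType) (q m : nat) (U : 'I_m -> 'M[R]_q) :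
  (0 < q)%N -> (0 < m)%N ->
  (forall j, (U j)^T = - U j) ->
  (forall c : 'I_m -> R, \sum_(j < m) c j *: U j = 0 -> forall j, c j = 0) ->
  forall (x : 'cV[R]_q) (t : 'cV[R]_m),
    (ereal_sup [set (phi U x t tau)%:E | tau in Omega_star U]
      <= dcc U x t * dcc U x t)%E.
Proof.
move=> _ _ skU _ x t; apply: ge_ereal_sup => _ [tau Otau <-].
set p := phi U x t tau.
(* Taking roots gives a bound that passes to the infimum of lengths. For negative [p] the root is 0
   by convention, and [p] is then below any square. *)
suff sqrt_le : ((Num.sqrt p)%:E <= dcc U x t)%E.
  have sqrt0 : (0 <= (Num.sqrt p)%:E)%E by rewrite lee_fin sqrtr_ge0.
  apply: (le_trans _ (lee_pmul sqrt0 sqrt0 sqrt_le sqrt_le)).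
  rewrite -EFinM lee_fin -expr2; have [p0|/ltW p0] := leP 0 p.
    by rewrite sqr_sqrtr.
  exact: le_trans p0 (sqr_ge0 _).
apply: le_ereal_inf_tmp => _ [xs [ts [hor x01 t01 ->]]].
have [->|Loo] := eqVneq (curve_length xs) +oo%E; first exact: leey.
have [acx [_ dxt]] := hor.
have [F [acF F0 mF dF F1]] : exists F : R -> R, [/\ abs_cont01 F,
    (forall s, 0 <= F s), (forall s r, s <= r -> F s <= F r),
    {ae (@lebesgue_measure R), forall s, 0 < s < 1 -> derivable F s 1 /\
      derive1 F s = Num.sqrt (\sum_(l < q) derive1 (xs l) s ^+ 2)} &
    ((F 1)%:E <= curve_length xs)%E].
  apply: arc_length_exists => //; last by rewrite ltey.
  have FF := ae_filter_ringOfSetsType (@lebesgue_measure R).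
  by apply: (filterS _ dxt) => s h /h [].
apply: le_trans F1; rewrite lee_fin -(ger0_norm (F0 1)) -sqrtr_sqr.
apply: ler_wsqrtr.
exact: (phi_le_arc_length skU Otau hor x01 t01 acF F0 mF dF).
Qed.
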